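(* For all integers $\alpha\ge0$ and $n\ge0$, \begin{align*} b_{5}\!\left(4\cdot5^{2\alpha+1}n+\tfrac{31\cdot 5^{2\alpha}-1}{6}\right)&\equiv 0\pmod 2,\\ b_{5}\!\left(4\cdot5^{2\alpha+1}n+\tfrac{79\cdot 5^{2\alpha}-1}{6}\right)&\equiv 0\pmod 2,\\ b_{5}\!\left(4\cdot5^{2\alpha+2}n+\tfrac{83\cdot 5^{2\alpha+1}-1}{6}\right)&\equiv 0\pmod 2,\\ b_{5}\!\left(4\cdot5^{2\alpha+2}n+\tfrac{107\cdot 5^{2\alpha+1}-1}{6}\right)&\equiv 0\pmod 2. \end{align*}
   Context: For a positive integer $\ell$, $b_\ell(n)$ denotes the number of partitions of $n$ having no part divisible by $\ell$. *)

(* Defs.v *)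
From mathcomp Require Import all_boot.
Set Implicit Arguments. Unset Strict Implicit. Unset Printing Implicit Defensive.

(* A partition of n is encoded by its multiplicity function:
   m : 'I_n -> 'I_n.+1, where m i is the number of parts equal to i.+1
   (every part of a partition of n lies in 1..n and occurs at most n times),
   subject to  \sum_i (i.+1) * m i = n.  This is a bijection with partitions. *)
Definition is_partition_mult (n : nat) (m : {ffun 'I_n -> 'I_n.+1}) : bool :=
  \sum_(i < n) i.+1 * m i == n.

Definition b (l n : nat) : nat :=
  #|[set m : {ffun 'I_n -> 'I_n.+1} | is_partition_mult m &
        [forall i : 'I_n, (l %| i.+1) ==> (val (m i) == 0)]]|.

(* Main.v *)
(* Write E_k for the product of the (1 - X^(k i)), i >= 1, over F_2, so that
   B E_1 = E_5 for B the generating function of b_5. The Jacobi triple product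
   and norms of Gaussian integers give E_1 E_5 = E_1^6 + X E_5^6 modulo 2. In
   B E_1^2 = E_1 E_5 write B = e^2 + X o^2; comparing even and odd exponents
   gives e = E_1^2 and o = E_5^2 B, so the even part of o is E_5 e = E_5 E_2,
   i.e. b_5(4k+1) is the coefficient of X^k in E_5 E_2. By the pentagonal number
   theorem it vanishes unless 24k+7 = 5x^2 + 2y^2; for the k at hand this is
   impossible by descent at 5 and quadratic residues.
   Power series are replaced by polynomials modulo X^N. *)
Require Import Defs.
From mathcomp Require Import all_boot all_algebra ring zify.
Set Implicit Arguments. Unset Strict Implicit. Unset Printing Implicit Defensive.
Import GRing.Theory.
Local Open Scope ring_scope.

(** * Congruence of polynomials modulo ['X^N], and truncated Euler products *)

Section Truncation.
Variable F : fieldType.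
Implicit Types (p q r : {poly F}) (N M k : nat).

Definition eqmodX N p q := 'X^N %| p - q.

Lemma eqmodXP N p q :
  reflect (forall i, (i < N)%N -> p`_i = q`_i) (eqmodX N p q).
Proof.
apply: (iffP idP) => [/dvdpP[r Er] i ltiN | Epq].
  by apply/eqP; rewrite -subr_eq0 -coefB Er coefMXn ltiN.
rewrite /eqmodX -(poly_take_drop N (p - q)) dvdp_addr ?dvdp_mull //.
suff -> : take_poly N (p - q) = 0 by [].
apply/polyP=> i; rewrite coef_take_poly coefB coef0.
by case: ifP => // /Epq ->; rewrite subrr.
Qed.

Lemma eqmodX_refl N p : eqmodX N p p.
Proof. exact/eqmodXP. Qed.

Lemma eqmodX_sym N p q : eqmodX N p q -> eqmodX N q p.
Proof. by move/eqmodXP=> E; apply/eqmodXP=> i /E. Qed.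

Lemma eqmodX_trans N p q r : eqmodX N p q -> eqmodX N q r -> eqmodX N p r.
Proof. by move/eqmodXP=> E /eqmodXP E'; apply/eqmodXP=> i Hi; rewrite E ?E'. Qed.

Lemma eqmodX_leq M N p q : (M <= N)%N -> eqmodX N p q -> eqmodX M p q.
Proof.
by move=> leMN /eqmodXP E; apply/eqmodXP=> i Hi; apply/E/(leq_trans Hi).
Qed.

Lemma eqmodXD N p q p' q' :
  eqmodX N p q -> eqmodX N p' q' -> eqmodX N (p + p') (q + q').
Proof. by rewrite /eqmodX opprD addrACA; apply: dvdp_add. Qed.

Lemma eqmodXM N p q p' q' :
  eqmodX N p q -> eqmodX N p' q' -> eqmodX N (p * p') (q * q').
Proof.
move=> E E'; rewrite /eqmodX.
have ->: p * p' - q * q' = (p - q) * p' + q * (p' - q') by ring.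
by rewrite dvdp_add ?(dvdp_mulr _ E) ?(dvdp_mull _ E').
Qed.

Lemma eqmodXX N p q k : eqmodX N p q -> eqmodX N (p ^+ k) (q ^+ k).
Proof.
move=> E; elim: k => [|k IHk]; first exact: eqmodX_refl.
by rewrite !exprS eqmodXM.
Qed.

(** A polynomial with nonzero constant term is coprime to ['X^N]; this stands in for dividing by an
    invertible power series. *)
Lemma eqmodX_mulI N p q r :
  r`_0 != 0 -> eqmodX N (r * p) (r * q) -> eqmodX N p q.
Proof.
move=> nz_r; rewrite /eqmodX -mulrBr Gauss_dvdpr //.
by rewrite coprimep_expl // coprimep_sym coprimepX /root horner_coef0.
Qed.

Lemma eqmodX_Xn N k p q :
  eqmodX N p q -> eqmodX (k + N) ('X^k * p) ('X^k * q).
Proof. by rewrite /eqmodX -mulrBr exprD; apply: dvdp_mul. Qed.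

Lemma eqmodX_sum N (I : Type) (s : seq I) (f g : I -> {poly F}) :
  (forall i, eqmodX N (f i) (g i)) ->
  eqmodX N (\sum_(i <- s) f i) (\sum_(i <- s) g i).
Proof.
move=> E; apply: (big_ind2 (eqmodX N)) => // *; first exact: eqmodX_refl.
exact: eqmodXD.
Qed.

Lemma eqmodX_prod1 N (I : Type) (s : seq I) (P : pred I) (f : I -> {poly F}) :
  (forall i, P i -> eqmodX N (f i) 1) -> eqmodX N (\prod_(i <- s | P i) f i) 1.
Proof.
move=> E; elim/big_rec: _ => [|i p Pi Ep]; first exact: eqmodX_refl.
by rewrite -[X in eqmodX _ _ X]mulr1 eqmodXM ?E.
Qed.

Lemma eqmodX_comp N k p q : (0 < k)%N ->
  eqmodX N p q -> eqmodX (k * N) (p \Po 'X^k) (q \Po 'X^k).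
Proof.
move=> k_gt0 /eqmodXP E; apply/eqmodXP=> i Hi; rewrite !coef_comp_poly_Xn //.
by case: ifP => // _; rewrite E // ltn_divLR // mulnC.
Qed.

Lemma eqmodX_even N p q :
  eqmodX N.*2 p q -> eqmodX N (even_poly p) (even_poly q).
Proof.
by move/eqmodXP=> E; apply/eqmodXP=> i Hi; rewrite !coef_even_poly E // ltn_double.
Qed.

Lemma eqmodX_odd N p q :
  eqmodX N.*2 p q -> eqmodX N (odd_poly p) (odd_poly q).
Proof.
move/eqmodXP=> E; apply/eqmodXP=> i Hi; rewrite !coef_odd_poly E //.
by rewrite ltn_Sdouble.
Qed.

Lemma eqmodX_1subXn N n : (N <= n)%N -> eqmodX N (1 - 'X^n) 1.
Proof.
move=> leNn; apply/eqmodXP=> i Hi; rewrite coefB coefXn.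
by rewrite [i == n]ltn_eqF ?subr0 // (leq_trans Hi).
Qed.

Definition qpoch (k m : nat) : {poly F} := \prod_(i < m) (1 - 'X^(k * i.+1)).

Lemma qpochS k m : qpoch k m.+1 = qpoch k m * (1 - 'X^(k * m.+1)).
Proof. exact: big_ord_recr. Qed.

Lemma qpoch_coef0 k m : (0 < k)%N -> (qpoch k m)`_0 = 1.
Proof.
move=> k_gt0; elim: m => [|m IHm]; first by rewrite /qpoch big_ord0 coef1.
rewrite qpochS -!horner_coef0 in IHm *.
by rewrite hornerM IHm !hornerE expr0n muln_eq0 eqn0Ngt k_gt0 /= subr0.
Qed.

Lemma qpoch_neq0 k m : (0 < k)%N -> (qpoch k m)`_0 != 0.
Proof. by move/qpoch_coef0->; apply: oner_neq0. Qed.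

(** Every further factor is 1 minus a power of X of degree at least [k * m.+1]. *)
Lemma qpoch_stable k m m' : (m <= m')%N -> eqmodX (k * m.+1) (qpoch k m') (qpoch k m).
Proof.
elim: m' => [|m' IHm].
  by rewrite leqn0 => /eqP->; apply: eqmodX_refl.
rewrite leq_eqVlt => /predU1P[->|lt_m]; first exact: eqmodX_refl.
rewrite qpochS -[X in eqmodX _ _ X]mulr1 eqmodXM ?IHm //.
by rewrite eqmodX_1subXn // leq_mul2l lt_m orbT.
Qed.

Lemma qpoch_comp k l m : qpoch k m \Po 'X^l = qpoch (l * k) m.
Proof.
rewrite /qpoch rmorph_prod /=; apply: eq_bigr => i _.
by rewrite rmorphB rmorph1 rmorphXn /= comp_polyX -exprM mulnA.
Qed.

End Truncation.

Lemma double_bin2 n : (2 * 'C(n, 2) = n * n.-1)%N.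
Proof.
by elim: n => // n IHn; rewrite binS bin1 mulnDr IHn /=; case: n {IHn} => // n; lia.
Qed.

(** * Gaussian binomial coefficients *)

Section GaussBinomial.
Variable R : comNzRingType.
Implicit Types q y z : R.

(** Defined by the q-Pascal rule, so no division occurs and [q] may be any ring element. *)
Fixpoint gbin q n k : R :=
  match n, k with
  | _, 0 => 1
  | 0, _.+1 => 0
  | n'.+1, k'.+1 => gbin q n' k' + q ^+ k'.+1 * gbin q n' k'.+1
  end.

Lemma gbin0 q n : gbin q n 0 = 1.
Proof. by case: n. Qed.

Lemma gbin_small q n k : (n < k)%N -> gbin q n k = 0.
Proof.
elim: n k => [|n IHn] [|k] //= ltnk.
by rewrite !IHn ?mulr0 ?addr0 // ltnW.
Qed.

Lemma gbinn q n : gbin q n n = 1.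
Proof. by elim: n => //= n ->; rewrite gbin_small // mulr0 addr0. Qed.

(** The q-binomial theorem, by splitting off the factor i = 0 and replacing [z] by [z * q] in the
    rest. The homogeneous form in [y] allows a later substitution that avoids negative exponents. *)
Lemma gauss_binomial q n y z :
  \prod_(i < n) (y + z * q ^+ i) =
  \sum_(k < n.+1) q ^+ 'C(k, 2) * gbin q n k * z ^+ k * y ^+ (n - k).
Proof.
elim: n z => [|n IHn] z.
  by rewrite big_ord0 big_ord1 /= bin0n !expr0 !mulr1.
rewrite big_ord_recl /= expr0 mulr1.
under eq_bigr => i _ do rewrite /bump /= add1n exprS mulrA.
rewrite IHn mulrDl !big_distrr /=.
rewrite [in RHS]big_ord_recl /= bin0n expr0 !mul1r subn0.
rewrite big_ord_recl /= bin0n gbin0 expr0 !mul1r subn0 -exprS -addrA; congr (_ + _).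
rewrite [in RHS](eq_bigr (fun i : 'I_n.+1 =>
  q ^+ 'C(i.+1, 2) * q ^+ i.+1 * gbin q n i.+1 * z ^+ i.+1 * y ^+ (n - i) +
  q ^+ 'C(i.+1, 2) * gbin q n i * z ^+ i.+1 * y ^+ (n - i))); last first.
  by move=> i _; rewrite /bump /= add1n subSS; ring.
rewrite big_split /= [in RHS]big_ord_recr /= gbin_small // mulr0 !mul0r addr0.
congr (_ + _); apply: eq_bigr => i _.
  rewrite /bump /= add1n -(subnSK (ltn_ord i)) exprMn [y ^+ (_.+1)]exprS; ring.
rewrite binS bin1 exprMn exprD exprS; ring.
Qed.

Lemma gbin_poch q n k : (k <= n)%N ->
  gbin q n k * \prod_(i < k) (1 - q ^+ i.+1) * \prod_(i < n - k) (1 - q ^+ i.+1) =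
  \prod_(i < n) (1 - q ^+ i.+1).
Proof.
elim: n k => [|n IHn] [|k] //= lekn; rewrite ?gbin0 ?big_ord0 ?mul1r //.
rewrite mulrDl mulrDl subSS; move: lekn; rewrite ltnS leq_eqVlt => /predU1P[->|ltkn].
  rewrite gbinn gbin_small // subnn !big_ord0 mulr0 !mul0r addr0 mulr1 mul1r //.
rewrite [in RHS]big_ord_recr /=.
have E1 := IHn _ (ltnW ltkn); have E2 := IHn _ ltkn.
have [d En] : exists d, n = (k.+1 + d)%N by exists (n - k.+1)%N; rewrite subnKC.
have Ed : (n - k = d.+1)%N by rewrite En addSn -addnS addKn.
have Ed' : (n - k.+1 = d)%N by rewrite En addKn.
have -> : n.+1 = (k.+1 + d.+1)%N by rewrite En addnS.
rewrite Ed Ed' !big_ord_recr /= in E1 E2 *.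
set P := \prod_(i < n) _ in E1 E2 *.
(* With n + 1 = (k + 1) + (d + 1), the two q-Pascal terms contribute the two parts of 1 - q^(n+1) =
   (1 - q^(k+1)) + q^(k+1) (1 - q^(d+1)). *)
transitivity (P * (1 - q ^+ k.+1) + P * (q ^+ k.+1 * (1 - q ^+ d.+1))).
  by rewrite -{1}E1 -E2; ring.
rewrite exprD; ring.
Qed.

End GaussBinomial.

(** * Theta series and the Jacobi triple product *)

Definition texp (a b : nat) (n : int) : nat :=
  match n with
  | Posz k => (a * 'C(k.+1, 2) + b * 'C(k, 2))%N
  | Negz k => (a * 'C(k.+1, 2) + b * 'C(k.+2, 2))%N
  end.

Lemma texpE a b n :
  (texp a b n)%:Z * 2 = a%:Z * (n * (n + 1)) + b%:Z * (n * (n - 1)).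
Proof.
case: n => k /=.
  by have := double_bin2 k; have := double_bin2 k.+1; case: k => [|k] /=; nia.
by have := double_bin2 k.+1; have := double_bin2 k.+2; rewrite NegzE /=; nia.
Qed.

(** The exponent is at least n^2. Hence the indices outside [zbox m] do not affect a theta series
    modulo ['X^m.+1]. *)
Lemma leq_absz_texp a b n : (0 < a)%N -> (0 < b)%N -> (`|n| <= texp a b n)%N.
Proof. by have := texpE a b n; nia. Qed.

Definition zbox (m : nat) : seq int := [seq j%:Z - m%:Z | j <- iota 0 (2 * m).+1].

Lemma mem_zbox m (n : int) : (n \in zbox m) = (`|n| <= m)%N.
Proof.
apply/mapP/idP => [[j]|le_n]; first by rewrite mem_iota => ? ->; lia.
by exists `|(n + m%:Z)%R|%N; [rewrite mem_iota; lia | lia].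
Qed.

Lemma zbox_uniq m : uniq (zbox m).
Proof. by rewrite map_inj_uniq ?iota_uniq // => i j; lia. Qed.

Section Theta.
Variable F : fieldType.

(** A partial sum of Ramanujan's theta function f(X^a, X^b). *)
Definition theta a b m : {poly F} := \sum_(n <- zbox m) 'X^(texp a b n).

(** The q-binomial theorem with 2m factors, q = X^(a+b), z = X^a and y = X^((a+b)m): the lower half
    of the factors yields the exponents with [b], the upper half those with [a]. *)
Lemma jacobi_triple_finite a b m :
  \prod_(i < m) ((1 + 'X^((a + b) * i + a)) * (1 + 'X^((a + b) * i + b))) =
  \sum_(j < (2 * m).+1) 'X^(texp a b (j%:Z - m%:Z)) * gbin ('X^(a + b)) (2 * m) j
    :> {poly F}.
Proof.
set k := (a + b)%N.
have := gauss_binomial ('X^k : {poly F}) (2 * m) 'X^(k * m) 'X^a.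
(* X^T is the factor cleared by replacing 1 + X^(a - k i) with X^(k i - a) + 1. *)
pose T := (\sum_(i < m) (a + k * i) + k * m * m)%N.
have sumT : (2 * T = 2 * (a * m) + k * (m * m.-1) + 2 * (k * m * m))%N.
  rewrite /T big_split /= sum_nat_const card_ord -big_distrr /=.
  rewrite -(big_mkord xpredT (fun i => i)) triangular_sum.
  by have := double_bin2 m; lia.
rewrite mul2n -addnn big_split_ord /=.
have -> : \prod_(i < m) ('X^(k * m) + 'X^a * 'X^k ^+ i) =
    \prod_(i < m) 'X^(a + k * i) * \prod_(i < m) (1 + 'X^(k * i + b)) :> {poly F}.
  (* Index i is matched with m-1-i, since (a + k i) + (k (m-1-i) + b) = k m. *)
  rewrite [X in _ = _ * X](reindex_inj rev_ord_inj) /= -big_split /=.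
  apply: eq_bigr => i _; rewrite mulrDr mulr1 -exprM -!exprD addrC; congr (_ + 'X^_).
  by have := ltn_ord i; rewrite /k; nia.
have -> : \prod_(i < m) ('X^(k * m) + 'X^a * 'X^k ^+ (m + i)) =
    \prod_(i < m) 'X^(k * m) * \prod_(i < m) (1 + 'X^(k * i + a)) :> {poly F}.
  rewrite -big_split /=; apply: eq_bigr => i _.
  by rewrite mulrDr mulr1 -exprM -!exprD; congr (_ + 'X^_); nia.
rewrite mulrACA -!big_split /= => E.
apply: (mulfI (_ : 'X^T != 0)); first by rewrite -size_poly_gt0 size_polyXn.
rewrite big_distrr /=.
transitivity (\prod_(i < m) ('X^(a + k * i) * 'X^(k * m)) *
  \prod_(i < m) ((1 + 'X^(k * i + b)) * (1 + 'X^(k * i + a))) : {poly F}).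
  congr (_ * _); last by apply: eq_bigr => i _; rewrite mulrC.
  rewrite big_split /= prodr_const card_ord -exprM.
  by rewrite /T exprD; congr (_ * _); elim/big_rec2: _ => //= i x y _ <-; rewrite exprD.
rewrite -big_split /= E; apply: eq_bigr => j _.
have := texpE a b (j%:Z - m%:Z); set e := texp _ _ _ => eE.
rewrite -!exprM mulrA -exprD.
have -> : (T + e = k * 'C(j, 2) + a * j + k * m * (m + m - j))%N.
  have : (k * m * (m + m - j) + k * m * j = k * m * (m + m))%N.
    by rewrite -mulnDr subnK // -ltnS.
  have := double_bin2 j; rewrite /k in sumT *; clearbody T e.
  by case: (nat_of_ord j) eE => [|j'] /=; case: (m) sumT => [|m'] /=; lia.
rewrite !exprD. ring.
Qed.
End Theta.

Section Jacobi.
Variable F : fieldType.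

(** By [gbin_poch] the left side is the square of [qpoch F k n] over the products of lengths j and n
    - j, and all of these agree up to the stated order. *)
Lemma gbin_qpoch_eqmod k n j r :
    (0 < k)%N -> (r <= j)%N -> (r <= n - j)%N -> (j <= n)%N ->
  eqmodX (k * r.+1) (gbin 'X^k n j * qpoch F k n) 1.
Proof.
move=> k_gt0 lerj lernj lejn.
have Q0 := qpoch_neq0 F n k_gt0.
apply: (eqmodX_mulI Q0); rewrite mulr1.
have := gbin_poch ('X^k : {poly F}) lejn.
have qE s : \prod_(i < s) (1 - 'X^k ^+ i.+1) = qpoch F k s.
  by apply: eq_bigr => i _; rewrite -exprM.
rewrite !qE => {3}<-.
have stab s : (r <= s)%N -> (s <= n)%N -> eqmodX (k * r.+1) (qpoch F k n) (qpoch F k s).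
  move=> lers lesn; apply: eqmodX_leq (qpoch_stable F k lesn).
  by rewrite leq_mul2l ltnS lers orbT.
rewrite mulrC; apply: eqmodXM; last exact/stab/leq_subr.
by apply: eqmodXM; [apply: eqmodX_refl | apply: stab].
Qed.

Lemma jacobi_triple a b m : (0 < a)%N -> (0 < b)%N ->
  eqmodX m.+1
    (\prod_(i < m) ((1 - 'X^((a + b) * i.+1)) *
                    ((1 + 'X^((a + b) * i + a)) * (1 + 'X^((a + b) * i + b)))))
    (theta F a b m).
Proof.
move=> a_gt0 b_gt0; have k_gt0 : (0 < a + b)%N by rewrite addn_gt0 a_gt0.
rewrite big_split /= -/(qpoch F (a + b) m) jacobi_triple_finite.
have le2m : (m <= 2 * m)%N by rewrite leq_pmull.
have E1 : eqmodX m.+1 (qpoch F (a + b) m) (qpoch F (a + b) (2 * m)).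
  apply: eqmodX_sym; apply: eqmodX_leq (qpoch_stable F (a + b) le2m).
  by rewrite leq_pmull.
apply: eqmodX_trans (eqmodXM E1 (eqmodX_refl _ _)) _.
rewrite /theta big_map -[iota _ _]/(index_iota 0 (2 * m).+1) big_mkord big_distrr /=.
apply: eqmodX_sum => j; rewrite mulrCA -[X in eqmodX _ _ X]mulr1.
have lej : (j <= 2 * m)%N by rewrite -ltnS.
have := leq_absz_texp (j%:Z - m%:Z) a_gt0 b_gt0; set e := texp _ _ _ => le_e.
(* The binomial is close to the limit only for j near m, but the factor X^e with e >= |j - m| makes
   up for the loss. *)
have [d [led1 led2 lemd]] : exists d, [/\ (d <= j)%N, (d <= 2 * m - j)%N & (m <= d + e)%N].
  by exists (m - `|(j%:Z - m%:Z)%R|)%N; split; lia.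
have := gbin_qpoch_eqmod k_gt0 led1 led2 lej.
rewrite [gbin _ _ _ * _]mulrC => /(eqmodX_Xn e); apply: eqmodX_leq.
by nia.
Qed.

End Jacobi.

(** * Gaussian integers and the identity between theta products *)

(* Completing squares, theta 1 4 * theta 2 3 enumerates the (m, n) with
   (10m-3)^2 + (10n-1)^2 = 10(4N+1), and theta 1 3 ^ 2 the (x, y) with
   (4x-1)^2 + (4y-1)^2 = 2(4N+1). The map divides (10m-3) - i(10n-1) by 1 - 2i
   and rotates by a unit so that both coordinates are 3 mod 4. Its image misses
   exactly the (x, y) with x + 2y = 2 mod 5; those are the image of
   [mul_by_norm5], which is multiplication by an element of norm 5. *)
Definition to_odd_squares (p : int * int) : int * int :=
  let: (m, n) := p in
  if (2 %| m)%Z then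
    if (2 %| n)%Z then (((m + 2 * n) %/ 2)%Z, ((2 * m - n) %/ 2)%Z)
    else (((1 - 2 * m + n) %/ 2)%Z, ((m + 2 * n) %/ 2)%Z)
  else
    if (2 %| n)%Z then (((2 * m - n) %/ 2)%Z, ((1 - m - 2 * n) %/ 2)%Z)
    else (((1 - m - 2 * n) %/ 2)%Z, ((1 - 2 * m + n) %/ 2)%Z).

Definition mul_by_norm5 (p : int * int) : int * int :=
  (2 * p.1 - p.2, 1 - p.1 - 2 * p.2).

Lemma to_odd_squares_inj : injective to_odd_squares.
Proof.
case=> m n [m' n']; rewrite /to_odd_squares.
by do 4!case: ifPn => ?; case=> ? ?; congr pair; lia.
Qed.

Lemma mul_by_norm5_inj : injective mul_by_norm5.
Proof. by case=> m n [m' n'] [] /= ? ?; congr pair; lia. Qed.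

Lemma odd_squares_residue m n x y : to_odd_squares (m, n) = (x, y) ->
  ((x + 2 * y) %% 5)%Z != 2.
Proof. by rewrite /to_odd_squares; do 2!case: ifPn => ?; case=> <- <-; lia. Qed.

(** The residues 0, 4, 3, 1 of x + 2y correspond to (m, n) being both even, both odd, even-odd and
    odd-even. The residue thus selects a branch, and the witness solves its linear system. *)
Lemma odd_squares_preimage x y : ((x + 2 * y) %% 5)%Z != 2 ->
  exists p, to_odd_squares p = (x, y).
Proof.
move=> Hxy.
have : [\/ ((x + 2 * y) %% 5)%Z = 0, ((x + 2 * y) %% 5)%Z = 4,
   ((x + 2 * y) %% 5)%Z = 3 | ((x + 2 * y) %% 5)%Z = 1].
  have : [|| ((x + 2 * y) %% 5)%Z == 0, ((x + 2 * y) %% 5)%Z == 4,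
   ((x + 2 * y) %% 5)%Z == 3 | ((x + 2 * y) %% 5)%Z == 1] by lia.
  by case/or4P=> /eqP ?; [constructor 1|constructor 2|constructor 3|constructor 4].
case=> r.
- exists (((2 * x + 4 * y) %/ 5)%Z, ((4 * x - 2 * y) %/ 5)%Z).
  by rewrite /to_odd_squares; do 2!case: ifPn => ?; congr pair; lia.
- exists (((3 - 2 * x - 4 * y) %/ 5)%Z, ((1 - 4 * x + 2 * y) %/ 5)%Z).
  by rewrite /to_odd_squares; do 2!case: ifPn => ?; congr pair; lia.
- exists (((2 - 4 * x + 2 * y) %/ 5)%Z, ((4 * y - 1 + 2 * x) %/ 5)%Z).
  by rewrite /to_odd_squares; do 2!case: ifPn => ?; congr pair; lia.
- exists (((1 - 2 * y + 4 * x) %/ 5)%Z, ((2 - 4 * y - 2 * x) %/ 5)%Z).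
  by rewrite /to_odd_squares; do 2!case: ifPn => ?; congr pair; lia.
Qed.

Lemma texp_odd_squares m n x y : to_odd_squares (m, n) = (x, y) ->
  (texp 1 3 x + texp 1 3 y = texp 1 4 m + texp 2 3 n)%N.
Proof.
move=> E.
have : [\/ 2 * x = m + 2 * n /\ 2 * y = 2 * m - n,
           2 * x = 1 - m - 2 * n /\ 2 * y = 1 - 2 * m + n,
           2 * x = 1 - 2 * m + n /\ 2 * y = m + 2 * n
         | 2 * x = 2 * m - n /\ 2 * y = 1 - m - 2 * n].
  move: E; rewrite /to_odd_squares; do 2!case: ifPn => ?; case=> <- <-.
  - by constructor 1; lia.
  - by constructor 3; lia.
  - by constructor 4; lia.
  - by constructor 2; lia.
have := texpE 1 3 x; have := texpE 1 3 y; have := texpE 1 4 m; have := texpE 2 3 n.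
(* The squares of the two relations supply x^2 and y^2; the goal is then linear in the monomials. *)
move=> En Em Ey Ex [] [Hx Hy];
  have := congr1 (fun z => z * z) Hx; have := congr1 (fun z => z * z) Hy => /= *; lia.
Qed.

Lemma texp_mul_by_norm5 x y :
  (texp 1 3 (mul_by_norm5 (x, y)).1 + texp 1 3 (mul_by_norm5 (x, y)).2 =
   5 * (texp 1 3 x + texp 1 3 y) + 1)%N.
Proof.
rewrite /mul_by_norm5 /=.
have := texpE 1 3 x; have := texpE 1 3 y.
by have := texpE 1 3 (2 * x - y); have := texpE 1 3 (1 - x - 2 * y); lia.
Qed.

(** The solutions on the left split according to whether x + 2y is 2 modulo 5, and each class is the
    injective image of one set on the right. *)
Lemma count_odd_squares m N : (N <= m)%N ->
  let L := [seq (x, y) | x <- zbox m, y <- zbox m] in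
  count (fun p => texp 1 3 p.1 + texp 1 3 p.2 == N)%N L =
  (count (fun p => texp 1 4 p.1 + texp 2 3 p.2 == N)%N L +
   count (fun p => 5 * (texp 1 3 p.1 + texp 1 3 p.2) + 1 == N)%N L)%N.
Proof.
move=> leNm L.
set PR := (fun _ => _).
set PA := (fun p => texp 1 4 _ + _ == _)%N.
set PB := (fun p => 5 * _ + _ == _)%N.
have uniqL : uniq L by rewrite allpairs_uniq ?zbox_uniq // => -[? ?] [? ?].
(* As N <= m, the box contains every solution of each of the three equations. *)
have memL a b a' b' x y : (0 < a)%N -> (0 < b)%N -> (0 < a')%N -> (0 < b')%N ->
  (texp a b x + texp a' b' y <= N)%N -> (x, y) \in L.
  move=> a0 b0 a0' b0' le_xy; rewrite allpairs_f // mem_zbox (leq_trans _ leNm) //.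
    by apply: leq_trans le_xy; rewrite (leq_trans (leq_absz_texp _ a0 b0)) ?leq_addr.
  by apply: leq_trans le_xy; rewrite (leq_trans (leq_absz_texp _ a0' b0')) ?leq_addl.
clearbody L.
have /perm_size : perm_eq (filter PR L)
    (map to_odd_squares (filter PA L) ++ map mul_by_norm5 (filter PB L)).
  apply: uniq_perm; first by rewrite filter_uniq.
    rewrite cat_uniq !map_inj_uniq ?filter_uniq //=; last 2 first.
    - exact: mul_by_norm5_inj.
    - exact: to_odd_squares_inj.
    rewrite andbT; apply/hasPn=> _ /mapP[[x y] _ ->].
    by apply/negP=> /mapP[[k l] _ /esym/odd_squares_residue] /=; lia.
  case=> x y; rewrite mem_filter mem_cat.
  apply/idP/idP => [/andP[/eqP /= Exy xyL] | /orP[] /mapP[[k l]]].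
  - have [r2|/odd_squares_preimage[[k l] Ekl]] := eqVneq ((x + 2 * y) %% 5)%Z 2.
      apply/orP; right; have [k [l [Ex Ey]]] : exists k l, x = 2 * k - l /\ y = 1 - k - 2 * l.
        by exists ((2 * x - y + 1) %/ 5)%Z, ((2 - x - 2 * y) %/ 5)%Z; lia.
      apply/mapP; exists (k, l); last by rewrite Ex Ey.
      have := texp_mul_by_norm5 k l; rewrite /= -Ex -Ey Exy => EN.
      by rewrite mem_filter /PB /= -EN eqxx (memL 1 3 1 3)%N //; lia.
    apply/orP; left; apply/mapP; exists (k, l); last by rewrite Ekl.
    have EN := texp_odd_squares Ekl; rewrite Exy in EN.
    by rewrite mem_filter /PA /= -EN eqxx (memL 1 4 2 3)%N // -EN.
  - rewrite mem_filter => /andP[/eqP /= EN _] /esym/texp_odd_squares; rewrite EN => Exy.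
    by rewrite /PR /= Exy eqxx (memL 1 3 1 3)%N // Exy.
  - rewrite mem_filter => /andP[/eqP /= EN _] /= [-> ->].
    have := texp_mul_by_norm5 k l; rewrite EN /= => Exy.
    by rewrite /PR /= Exy eqxx (memL 1 3 1 3)%N // Exy.
by rewrite size_cat !size_map !size_filter.
Qed.

Section ThetaIdentity.
Variable F : fieldType.

Lemma coef_sum_Xn (I : Type) (s : seq I) (f : I -> nat) N :
  (\sum_(i <- s) 'X^(f i) : {poly F})`_N = (count (fun i => f i == N) s)%:R.
Proof.
rewrite coef_sum -sum1_count natr_sum [RHS]big_mkcond /=.
by apply: eq_bigr => i _; rewrite coefXn eq_sym; case: eqP.
Qed.

Lemma theta_mul a b a' b' m :
  theta F a b m * theta F a' b' m =
  \sum_(p <- [seq (x, y) | x <- zbox m, y <- zbox m])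
     'X^(texp a b p.1 + texp a' b' p.2).
Proof.
rewrite big_allpairs big_distrlr /=; apply: eq_bigr => x _; apply: eq_bigr => y _.
by rewrite exprD.
Qed.

(** The coefficientwise form of [count_odd_squares], valid over any field. *)
Lemma theta_identity m :
  eqmodX m.+1 (theta F 1 3 m ^+ 2)
    (theta F 1 4 m * theta F 2 3 m + (theta F 1 3 m \Po 'X^5) ^+ 2 * 'X).
Proof.
apply/eqmodXP=> N ltNm.
have -> : (theta F 1 3 m \Po 'X^5) ^+ 2 * 'X =
    \sum_(p <- [seq (x, y) | x <- zbox m, y <- zbox m])
      'X^(5 * (texp 1 3 p.1 + texp 1 3 p.2) + 1).
  rewrite -rmorphXn /= expr2 theta_mul rmorph_sum /= big_distrl /=.
  by apply: eq_bigr => p _; rewrite rmorphXn /= comp_polyX -exprM exprD expr1.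
by rewrite expr2 !theta_mul coefD !coef_sum_Xn count_odd_squares // natrD.
Qed.

End ThetaIdentity.

(** * Euler products and theta series modulo 2 *)

Lemma pchar_polyF2 : 2%N \in [pchar {poly 'F_2}].
Proof. by rewrite pchar_poly pchar_Fp. Qed.

Lemma oppr_polyF2 (p : {poly 'F_2}) : - p = p.
Proof. exact: oppr_pchar2 pchar_polyF2 p. Qed.

Lemma sqr_polyF2 (p : {poly 'F_2}) : p ^+ 2 = p \Po 'X^2.
Proof.
elim/poly_ind: p => [|p c IHp]; first by rewrite expr0n comp_poly0.
rewrite -(pFrobenius_autE pchar_polyF2) rmorphD rmorphM /= !pFrobenius_autE.
rewrite rmorphD rmorphM /= comp_polyX comp_polyC IHp -rmorphXn /=.
by congr (_ + _%:P); apply: val_inj; case: c => [[|[|]]].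
Qed.

(** Blocks of k consecutive factors, to be compared with the i-th factor of a triple product. *)
Lemma qpoch_mul l m k :
  qpoch 'F_2 l (m * k) = \prod_(i < m) \prod_(j < k) (1 + 'X^(l * (k * i + j).+1)).
Proof.
rewrite /qpoch -(big_mkord xpredT (fun i => 1 - 'X^(l * i.+1))) big_nat_mul big_mkord.
apply: eq_bigr => i _.
rewrite -{1}[(i * k)%N]add0n big_addn mulSn addnK big_mkord.
by apply: eq_bigr => j _; rewrite oppr_polyF2 [(k * i)%N]mulnC [(i * k + j)%N]addnC.
Qed.

Section EtaF2.
Local Notation E k m := (qpoch 'F_2 k m).

Lemma qpoch_sqr k m : E k m ^+ 2 = E (2 * k) m.
Proof. by rewrite sqr_polyF2 qpoch_comp. Qed.

Lemma qpoch_stable1 k m m' : (0 < k)%N -> (m <= m')%N -> eqmodX m.+1 (E k m') (E k m).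
Proof.
move=> k_gt0 le_m; apply: eqmodX_leq (qpoch_stable _ k le_m).
by rewrite leq_pmull.
Qed.

(** The pentagonal number theorem modulo 2: the exponents 3i+1, 3i+2, 3i+3 exhaust the positive
    integers. *)
Lemma theta12_F2 m : eqmodX m.+1 (theta 'F_2 1 2 m) (E 1 m).
Proof.
have le_m : (m <= m * 3)%N by rewrite leq_pmulr.
apply: eqmodX_trans (qpoch_stable1 (ltnSn 0) le_m).
apply: eqmodX_trans (eqmodX_sym (jacobi_triple 'F_2 m (ltn0Sn 0) (ltn0Sn 1))) _.
rewrite (_ : \prod_(i < m) _ = E 1 (m * 3)) ?eqmodX_refl //.
rewrite qpoch_mul; apply: eq_bigr => i _.
rewrite !big_ord_recl big_ord0 /= /bump /= oppr_polyF2 mulr1.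
rewrite mulrC -mulrA; congr ((1 + 'X^_) * ((1 + 'X^_) * (1 + 'X^_))); lia.
Qed.

(** The triple product has exponents 4i+1, 4i+3, 4i+4. Multiplication by E_1^2 = E_2 adds 4i+2 and a
    second 4i+4, which gives E_1 E_4 = E_1^5; then E_1^2 is cancelled. *)
Lemma theta13_F2 m : eqmodX m.+1 (theta 'F_2 1 3 m) (E 1 m ^+ 3).
Proof.
have E0 : (E 1 m ^+ 2)`_0 != 0 by rewrite qpoch_sqr qpoch_neq0.
apply: (eqmodX_mulI E0).
have J := jacobi_triple 'F_2 m (ltn0Sn 0) (ltn0Sn 2).
apply: eqmodX_trans (eqmodX_sym (eqmodXM (eqmodX_refl _ _) J)) _.
have le_m2 : (m <= m * 2)%N by rewrite leq_pmulr.
have le_m4 : (m <= m * 4)%N by rewrite leq_pmulr.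
rewrite qpoch_sqr.
apply: eqmodX_trans (eqmodXM (eqmodX_sym (qpoch_stable1 (ltn0Sn 1) le_m2)) (eqmodX_refl _ _)) _.
have -> : E (2 * 1) m * E 1 m ^+ 3 = E 1 m * E 4 m.
  by rewrite -[4%N]/(2 * (2 * 1))%N -!qpoch_sqr; ring.
apply: eqmodX_trans (eqmodXM (qpoch_stable1 (ltn0Sn 0) le_m4) (eqmodX_refl _ _)).
rewrite (_ : _ * \prod_(i < m) _ = E 1 (m * 4) * E 4 m) ?eqmodX_refl //.
rewrite !qpoch_mul /qpoch -!big_split /=; apply: eq_bigr => i _.
rewrite !big_ord_recl !big_ord0 /= /bump /= !oppr_polyF2 !mulr1.
have XE n n' : n = n' -> 1 + 'X^n = 1 + 'X^n' :> {poly 'F_2} by move=> ->.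
rewrite (XE (2 * (2 * i + 0).+1) (1 * (4 * i + (1 + 0)).+1))%N; last lia.
rewrite (XE (2 * (2 * i + (1 + 0)).+1) (4 * i.+1))%N; last lia.
rewrite (XE (1 * (4 * i + 0).+1) (4 * i + 1))%N; last lia.
rewrite (XE (1 * (4 * i + (1 + (1 + 0))).+1) (4 * i + 3))%N; last lia.
rewrite (XE (1 * (4 * i + (1 + (1 + (1 + 0)))).+1) (4 * i.+1))%N; last lia.
ring.
Qed.

(** Together the two triple products have each exponent prime to 5 once and each multiple of 5
    twice. *)
Lemma theta14_theta23_F2 m :
  eqmodX m.+1 (theta 'F_2 1 4 m * theta 'F_2 2 3 m) (E 1 m * E 5 m).
Proof.
have J1 := jacobi_triple 'F_2 m (ltn0Sn 0) (ltn0Sn 3).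
have J2 := jacobi_triple 'F_2 m (ltn0Sn 1) (ltn0Sn 2).
apply: eqmodX_trans (eqmodX_sym (eqmodXM J1 J2)) _.
have le_m5 : (m <= m * 5)%N by rewrite leq_pmulr.
apply: eqmodX_trans (eqmodXM (qpoch_stable1 (ltn0Sn 0) le_m5) (eqmodX_refl _ _)).
rewrite -big_split /= (_ : \prod_(i < m) _ = E 1 (m * 5) * E 5 m) ?eqmodX_refl //.
rewrite qpoch_mul /qpoch -!big_split /=; apply: eq_bigr => i _.
rewrite !big_ord_recl !big_ord0 /= /bump /= !oppr_polyF2 !mulr1.
have XE n n' : n = n' -> 1 + 'X^n = 1 + 'X^n' :> {poly 'F_2} by move=> ->.
rewrite (XE (1 * (5 * i + 0).+1) (5 * i + 1))%N; last lia.
rewrite (XE (1 * (5 * i + (1 + 0)).+1) (5 * i + 2))%N; last lia.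
rewrite (XE (1 * (5 * i + (1 + (1 + 0))).+1) (5 * i + 3))%N; last lia.
rewrite (XE (1 * (5 * i + (1 + (1 + (1 + 0)))).+1) (5 * i + 4))%N; last lia.
rewrite (XE (1 * (5 * i + (1 + (1 + (1 + (1 + 0))))).+1) (5 * i.+1))%N; last lia.
ring.
Qed.

Lemma qpoch1_qpoch5_F2 m :
  eqmodX m.+1 (E 1 m * E 5 m) ((E 1 m ^+ 3) ^+ 2 + (E 5 m ^+ 3) ^+ 2 * 'X).
Proof.
have T2 := eqmodXX 2 (theta13_F2 m).
have T5 : eqmodX m.+1 (theta 'F_2 1 3 m \Po 'X^5) (E 5 m ^+ 3).
  have := eqmodX_comp (ltn0Sn 4) (theta13_F2 m); rewrite rmorphXn /= qpoch_comp.
  by apply: eqmodX_leq; rewrite leq_pmull.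
have := theta_identity 'F_2 m.
move/eqmodXP: T2 => T2; move/eqmodXP: (eqmodXM (eqmodXX 2 T5) (eqmodX_refl _ 'X)) => T5'.
move/eqmodXP: (theta14_theta23_F2 m) => T1 /eqmodXP T; apply/eqmodXP=> i lti.
(* Substituting [theta_identity] makes the term in E_5 occur twice, so it vanishes modulo 2. *)
rewrite coefD -T1 // -T2 // -T5' // T // coefD -addrA -mulr2n.
by rewrite -mulr_natr (_ : 2%:R = 0) ?mulr0 ?addr0 //; apply: val_inj.
Qed.

End EtaF2.

(** * Dissection by parity of exponents, and the support of E_5 E_2 *)

Section Dissection.
Local Notation E k m := (qpoch 'F_2 k m).

Lemma even_odd_sqr (p q : {poly 'F_2}) :
  even_poly (p ^+ 2 + q ^+ 2 * 'X) = p /\ odd_poly (p ^+ 2 + q ^+ 2 * 'X) = q.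
Proof.
split; apply/polyP=> i; rewrite ?coef_even_poly ?coef_odd_poly coefD coefMX.
  rewrite (sqr_polyF2 p) (sqr_polyF2 q) !coef_comp_poly_Xn // dvdn2 odd_double -muln2 mulnK //.
  case: i => [|i] /=; first by rewrite addr0.
  by rewrite muln2 dvdn2 /= odd_double addr0.
rewrite (sqr_polyF2 p) (sqr_polyF2 q) !coef_comp_poly_Xn //= !dvdn2 /=.
by rewrite odd_double -muln2 mulnK ?add0r.
Qed.

Lemma even_odd_sqrE (p : {poly 'F_2}) :
  p = even_poly p ^+ 2 + odd_poly p ^+ 2 * 'X.
Proof. by rewrite (sqr_polyF2 (even_poly p)) (sqr_polyF2 (odd_poly p)) poly_even_odd. Qed.

(** Each of the two extractions halves the precision, hence the initial modulus 4(n+1). *)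
Lemma dissection4_F2 (B : {poly 'F_2}) n m :
    (4 * n.+1 <= m)%N -> eqmodX (4 * n.+1) (B * E 1 m) (E 5 m) ->
  B`_(4 * n + 1) = (E 5 m * E 2 m)`_n.
Proof.
set N := (4 * n.+1)%N; move=> leNm BE.
have N2 : N = (2 * n.+1).*2 by rewrite /N; lia.
have E1_0 := qpoch_neq0 'F_2 m (ltn0Sn 0).
pose e := even_poly B; pose o := odd_poly B.
have BE2 : eqmodX N ((E 1 m * e) ^+ 2 + (E 1 m * o) ^+ 2 * 'X)
    ((E 1 m ^+ 3) ^+ 2 + (E 5 m ^+ 3) ^+ 2 * 'X).
  apply: eqmodX_trans (eqmodX_leq (leqW leNm) (qpoch1_qpoch5_F2 m)).
  rewrite (_ : _ + _ = E 1 m * (B * E 1 m)).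
    exact: eqmodXM (eqmodX_refl _ _) BE.
  by rewrite [in RHS](even_odd_sqrE B) -/e -/o; ring.
rewrite N2 in BE2.
(* Even parts give E_1 e = E_1^3. *)
have Ee : eqmodX (2 * n.+1) e (E 1 m ^+ 2).
  have := eqmodX_even BE2; rewrite !(proj1 (even_odd_sqr _ _)) exprS.
  exact: eqmodX_mulI.
(* Odd parts give E_1 o = E_5^3 = E_5^2 B E_1, so o = E_5^2 B. *)
have Eo : eqmodX (2 * n.+1) o ((E 5 m * e) ^+ 2 + (E 5 m * o) ^+ 2 * 'X).
  have := eqmodX_odd BE2; rewrite !(proj2 (even_odd_sqr _ _)) => Eo.
  apply: (eqmodX_mulI E1_0); apply: eqmodX_trans Eo _.
  rewrite (_ : E 1 m * _ = E 5 m ^+ 2 * (B * E 1 m)); last first.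
    by rewrite [in RHS](even_odd_sqrE B) -/e -/o; ring.
  rewrite exprSr; apply: eqmodXM (eqmodX_refl _ _) _.
  by apply: eqmodX_sym; apply: eqmodX_leq BE; rewrite N2 -addnn leq_addr.
rewrite mul2n in Eo; have := eqmodX_even Eo; rewrite (proj1 (even_odd_sqr _ _)) => Eeo.
have E2 : eqmodX n.+1 (E 5 m * e) (E 5 m * E 2 m).
  apply: eqmodXM (eqmodX_refl _ _) _; rewrite -[2%N]/(2 * 1)%N -qpoch_sqr.
  by apply: eqmodX_leq Ee; rewrite leq_pmull.
have /eqmodXP/(_ n (ltnSn n)) <- := eqmodX_trans Eeo E2.
rewrite coef_even_poly coef_odd_poly; congr (_`_ _); lia.
Qed.

(** Pentagonal exponents i = n(3n-1)/2 satisfy 24i + 1 = (6n-1)^2. *)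
Lemma qpoch1_support m i : (i <= m)%N -> (E 1 m)`_i != 0 ->
  exists x, (24 * i + 1 = x ^ 2)%N.
Proof.
move=> leim; have /eqmodXP <- // := theta12_F2 m.
rewrite /theta coef_sum_Xn => nz.
have /hasP[n _ /eqP En] : has (fun n => texp 1 2 n == i) (zbox m).
  by rewrite has_count lt0n; apply: contraNneq nz => ->.
exists `|(6 * n - 1)%R|%N; have := texpE 1 2 n; rewrite En; nia.
Qed.

(** A nonzero term has n = 5k + 2l with k, l pentagonal, and 24n + 7 = 5(24k+1) + 2(24l+1). *)
Lemma qpoch5_qpoch2_support m n : (n <= m)%N -> (E 5 m * E 2 m)`_n != 0 ->
  exists x y, (24 * n + 7 = 5 * x ^ 2 + 2 * y ^ 2)%N.
Proof.
move=> lenm; rewrite coefM => nz.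
have [i Hi] : exists i : 'I_n.+1, (E 5 m)`_i * (E 2 m)`_(n - i) != 0.
  apply/existsP; apply: contraNT nz => /existsPn H.
  by rewrite big1 // => i _; apply/eqP; rewrite -[_ == _]negbK H.
move: Hi; rewrite mulf_eq0 negb_or => /andP[].
rewrite -[5%N]muln1 -[2%N]muln1 -!qpoch_comp !coef_comp_poly_Xn //.
case: ifP => [/dvdnP[k Ek]|_]; last by rewrite eqxx.
case: ifP => [/dvdnP[l El]|_]; last by rewrite eqxx.
have := ltn_ord i; rewrite El Ek !mulnK // => lti.
case/qpoch1_support=> [|x Ex]; first by lia.
case/qpoch1_support=> [|y Ey]; first by lia.
by exists x, y; rewrite -Ex -Ey; lia.
Qed.

End Dissection.

(** * Generating functions of l-regular partitions *)

Section RegularPartitions.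
Variables (F : fieldType) (l : nat).

(** The ranges of i and j copy the multiplicity functions in [b], so that expanding the product
    gives a sum over them. *)
Definition regular_poly n : {poly F} :=
  \prod_(i < n) \sum_(j < n.+1 | (l %| i.+1)%N ==> (val j == 0)) 'X^(i.+1 * j).

Definition regular_qpoch n : {poly F} :=
  \prod_(i < n | ~~ (l %| i.+1)%N) (1 - 'X^(i.+1)).

Lemma coef_regular_poly n : (regular_poly n)`_n = (b l n)%:R.
Proof.
rewrite /regular_poly (bigA_distr_big_dep _ (fun (i : 'I_n) (j : 'I_n.+1) => 'X^(i.+1 * j))).
rewrite coef_sum /b -sum1_card natr_sum big_mkcond [RHS]big_mkcond /=.
apply: eq_bigr => m _; rewrite [in RHS]inE andbC -expr_sum coefXn eq_sym.
rewrite (_ : (m \in family _) =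
    [forall i : 'I_n, (l %| i.+1)%N ==> (val (m i) == 0)]); last exact/familyP/forallP.
by case: ifP => //= _; rewrite /is_partition_mult; case: eqP.
Qed.

Lemma regular_qpoch_coef0 n : (regular_qpoch n)`_0 = 1.
Proof.
rewrite /regular_qpoch -horner_coef0 horner_prod big1 // => i _.
by rewrite !hornerE expr0n /= subr0.
Qed.

(** Each truncated geometric series times its 1 - X^(i+1) is 1 - X^((i+1)(n+1)). *)
Lemma regular_polyK n : eqmodX n.+1 (regular_poly n * regular_qpoch n) 1.
Proof.
rewrite /regular_poly /regular_qpoch [X in _ * X]big_mkcond -big_split /=.
apply: eqmodX_prod1 => i _; case: ifP => [/negbTE-> | /negbFE->] /=.
  rewrite mulrC (_ : _ * _ = 1 - 'X^(i.+1 * n.+1)).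
    by apply: eqmodX_1subXn; rewrite leq_pmull.
  rewrite [in RHS]exprM -[RHS]opprB subrX1 -mulNr opprB; congr (_ * _).
  by apply: eq_bigr => j _; rewrite exprM.
by rewrite mulr1 (big_pred1 ord0) ?muln0 ?eqmodX_refl // => j.
Qed.

Lemma regular_qpoch_stable n m : (n <= m)%N ->
  eqmodX n.+1 (regular_qpoch m) (regular_qpoch n).
Proof.
elim: m => [|m IHm]; first by rewrite leqn0 => /eqP->; apply: eqmodX_refl.
rewrite leq_eqVlt => /predU1P[->|ltnm]; first exact: eqmodX_refl.
apply: eqmodX_trans (IHm ltnm).
rewrite /regular_qpoch big_mkcond big_ord_recr -big_mkcond /=.
rewrite -[X in eqmodX _ _ X]mulr1 eqmodXM ?eqmodX_refl //.
by case: ifP => _; rewrite ?eqmodX_refl // eqmodX_1subXn.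
Qed.

(** Modulo ['X^n.+1] both polynomials are inverse to [regular_qpoch n]. *)
Lemma coef_regular_poly_leq n m : (n <= m)%N -> (regular_poly m)`_n = (b l n)%:R.
Proof.
move=> lenm; rewrite -coef_regular_poly.
suff /eqmodXP-> : eqmodX n.+1 (regular_poly m) (regular_poly n) by [].
have Q0 : (regular_qpoch n)`_0 != 0 by rewrite regular_qpoch_coef0 oner_neq0.
apply: (eqmodX_mulI Q0); rewrite ![regular_qpoch n * _]mulrC.
apply: eqmodX_trans (eqmodX_sym (regular_polyK n)).
have E1 := eqmodXM (eqmodX_refl n.+1 (regular_poly m)) (regular_qpoch_stable lenm).
by apply: eqmodX_trans (eqmodX_sym E1) (eqmodX_leq _ (regular_polyK m)).
Qed.

End RegularPartitions.

Lemma regular_qpoch_qpoch (F : fieldType) l m : (0 < l)%N ->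
  regular_qpoch F l (m * l) * qpoch F l m = qpoch F 1 (m * l).
Proof.
move=> l_gt0; rewrite /qpoch [RHS](bigID (fun i : 'I_(m * l) => ~~ (l %| i.+1)%N)) /=.
congr (_ * _); first by apply: eq_bigr => i _; rewrite mul1n.
rewrite -(big_mkord (fun i => ~~ ~~ (l %| i.+1)%N) (fun i => 1 - 'X^(1 * i.+1))).
rewrite [RHS]big_mkcond big_nat_mul big_mkord; apply: eq_bigr => i _.
rewrite -{1}[(i * l)%N]add0n big_addn mulSn addnK big_mkord.
have lt_l : (l.-1 < l)%N by rewrite prednK.
(* In a block of l consecutive exponents only the last is a multiple of l. *)
rewrite (bigD1 (Ordinal lt_l)) //= big1 => [|j].
  by rewrite mulr1 -addSn prednK // -mulSn dvdn_mull // mul1n mulnC.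
rewrite -val_eqE /= => ne_j; rewrite -addSn dvdn_addl ?dvdn_mull // gtnNdvd //.
by have := ltn_ord j; lia.
Qed.

Lemma b5_mod2 n m : (4 * n.+1 <= m)%N ->
  (b 5 (4 * n + 1))%:R = (qpoch 'F_2 5 m * qpoch 'F_2 2 m)`_n.
Proof.
move=> lenm; have le_m5 : (m <= m * 5)%N by rewrite leq_pmulr.
(* The length m * 5 lets [regular_qpoch_qpoch] pair the product with exactly m factors of E_5. *)
rewrite -(dissection4_F2 (B := regular_poly 'F_2 5 (m * 5)) lenm).
  by rewrite coef_regular_poly_leq //; lia.
apply: eqmodX_leq (leqW lenm) _.
apply: eqmodX_trans (eqmodXM (eqmodX_refl _ _) (eqmodX_sym (qpoch_stable1 (ltn0Sn 0) le_m5))) _.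
rewrite -regular_qpoch_qpoch // mulrA -[X in eqmodX _ _ X]mul1r.
apply: eqmodXM (eqmodX_refl _ _).
by apply: eqmodX_leq (regular_polyK _ _ _); rewrite ltnS.
Qed.

Lemma b5_even_of_no_rep k :
  (forall x y, (24 * k + 7 <> 5 * x ^ 2 + 2 * y ^ 2)%N) ->
  b 5 (4 * k + 1) = 0 %[mod 2].
Proof.
move=> no_rep; apply/eqP; rewrite mod0n -/(dvdn 2 _) (dvdn_pcharf (pchar_Fp (isT : prime 2))).
rewrite (b5_mod2 (leqnn (4 * k.+1))); apply/negP => /negP nz.
have lekm : (k <= 4 * k.+1)%N by lia.
by have [x [y /no_rep]] := qpoch5_qpoch2_support lekm nz.
Qed.

(* Numbers not of the form 5x^2 + 2y^2 *)
Close Scope ring_scope.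

Lemma sqrn_mod5 x : (x ^ 2 %% 5 == 0) || (x ^ 2 %% 5 == 1) || (x ^ 2 %% 5 == 4).
Proof. by rewrite -modnXm; have := ltn_pmod x (isT : 0 < 5); case: (x %% 5) => [|[|[|[|[|]]]]]. Qed.

(** First 5 divides y; then 25 divides 5x^2, so 5 divides x. *)
Lemma descent5 x y M : 25 * M = 5 * x ^ 2 + 2 * y ^ 2 ->
  exists x' y', M = 5 * x' ^ 2 + 2 * y' ^ 2.
Proof.
move=> E; have /dvdnP[z Ez] : 5 %| y.
  have : 5 %| 2 * y ^ 2 by lia.
  by rewrite Gauss_dvdr // Euclid_dvdX // => /andP[].
have /dvdnP[w Ew] : 5 %| x.
  have : 5 %| x ^ 2 by nia.
  by rewrite Euclid_dvdX // => /andP[].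
by exists w, z; subst; lia.
Qed.

Lemma no_rep_pow25 alpha M : (forall x y, M <> 5 * x ^ 2 + 2 * y ^ 2) ->
  forall x y, 25 ^ alpha * M <> 5 * x ^ 2 + 2 * y ^ 2.
Proof.
move=> noM; elim: alpha => [|alpha IH] x y; first by rewrite mul1n.
by rewrite expnS -mulnA => /descent5[x' [y' /IH]].
Qed.

(** Modulo 5 the form is 2y^2, which only takes the values 0, 2, 3. *)
Lemma no_rep_14 M x y : (M %% 5 == 1) || (M %% 5 == 4) -> M <> 5 * x ^ 2 + 2 * y ^ 2.
Proof. by move=> HM EM; have := sqrn_mod5 y; lia. Qed.

(** Here y = 5z, so M = x^2 + 10z^2 is a square modulo 5. *)
Lemma no_rep_23 M x y : (M %% 5 == 2) || (M %% 5 == 3) -> 5 * M <> 5 * x ^ 2 + 2 * y ^ 2.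
Proof.
move=> HM EM; have /dvdnP[z Ez] : 5 %| y.
  have : 5 %| 2 * y ^ 2 by lia.
  by rewrite Gauss_dvdr // Euclid_dvdX // => /andP[].
by have := sqrn_mod5 x; subst; lia.
Qed.

Lemma pow25_mod24 alpha : exists t, 25 ^ alpha = 24 * t + 1.
Proof.
elim: alpha => [|alpha [t IH]]; first by exists 0.
by exists (25 * t + 1); rewrite expnS IH; lia.
Qed.

Theorem theorem3p20 (alpha n : nat) :
  [/\ b 5 (4 * 5 ^ (2 * alpha + 1) * n + (31 * 5 ^ (2 * alpha) - 1) %/ 6) = 0 %[mod 2],
      b 5 (4 * 5 ^ (2 * alpha + 1) * n + (79 * 5 ^ (2 * alpha) - 1) %/ 6) = 0 %[mod 2],
      b 5 (4 * 5 ^ (2 * alpha + 2) * n + (83 * 5 ^ (2 * alpha + 1) - 1) %/ 6) = 0 %[mod 2]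
    & b 5 (4 * 5 ^ (2 * alpha + 2) * n + (107 * 5 ^ (2 * alpha + 1) - 1) %/ 6) = 0 %[mod 2]].
Proof.
(* Writing 25^alpha = 24t + 1 resolves the division by 6 and shows each argument to be of the form
   4k + 1. *)
have [t Et] := pow25_mod24 alpha.
have Et' : 5 ^ (2 * alpha) = 24 * t + 1 by rewrite expnM.
rewrite !(expnD 5 (2 * alpha)) Et' expn1 -[5 ^ 2]/25.
split.
- have -> : 4 * ((24 * t + 1) * 5) * n + (31 * (24 * t + 1) - 1) %/ 6 =
    4 * (5 * (24 * t + 1) * n + 31 * t + 1) + 1 by lia.
  apply: b5_even_of_no_rep => x y.
  (* 24k + 7 splits off 25^alpha; the cofactor 120n + 31 is 1 modulo 5. The other cases run alike,
     with an extra factor 5 in the last two. *)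
  rewrite (_ : 24 * _ + 7 = 25 ^ alpha * (120 * n + 31)); last by rewrite Et; lia.
  by apply: no_rep_pow25 => {}x {}y; apply: no_rep_14; lia.
- have -> : 4 * ((24 * t + 1) * 5) * n + (79 * (24 * t + 1) - 1) %/ 6 =
    4 * (5 * (24 * t + 1) * n + 79 * t + 3) + 1 by lia.
  apply: b5_even_of_no_rep => x y.
  rewrite (_ : 24 * _ + 7 = 25 ^ alpha * (120 * n + 79)); last by rewrite Et; lia.
  by apply: no_rep_pow25 => {}x {}y; apply: no_rep_14; lia.
- have -> : 4 * ((24 * t + 1) * 25) * n + (83 * ((24 * t + 1) * 5) - 1) %/ 6 =
    4 * (25 * (24 * t + 1) * n + 415 * t + 17) + 1 by lia.
  apply: b5_even_of_no_rep => x y.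
  rewrite (_ : 24 * _ + 7 = 25 ^ alpha * (5 * (120 * n + 83))); last by rewrite Et; lia.
  by apply: no_rep_pow25 => {}x {}y; apply: no_rep_23; lia.
- have -> : 4 * ((24 * t + 1) * 25) * n + (107 * ((24 * t + 1) * 5) - 1) %/ 6 =
    4 * (25 * (24 * t + 1) * n + 535 * t + 22) + 1 by lia.
  apply: b5_even_of_no_rep => x y.
  rewrite (_ : 24 * _ + 7 = 25 ^ alpha * (5 * (120 * n + 107))); last by rewrite Et; lia.
  by apply: no_rep_pow25 => {}x {}y; apply: no_rep_23; lia.
Qed.
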